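(* Let $\Omega$ be a domain in $\mathbb{R}^3$, let $\omega\subset\Omega$ be a fixed (measurable) subset, let $T_0\in\mathbb{R}^{3\times3}$ be a constant matrix, let $T\in L^\infty(\Omega;\mathbb{R}^{3\times3})$ be given by $T:=T_0\chi_\omega$, and let $$\tilde F(u)=\int_\Omega|\nabla u|^2+T\cdot\mathrm{cof}\,\nabla u\,dx .$$ Assume that $|T_0|\le2\sqrt3$. Then $\tilde F(u)\ge0$ for all $u\in C_c^\infty(\Omega;\mathbb{R}^3)$. Moreover, if $|T_0|<2\sqrt3$, there is $\gamma>0$ such that $$\tilde F(u)\ge\gamma\int_\Omega|\nabla u|^2\,dx\qquad\text{for all }u\in H^1_0(\Omega;\mathbb{R}^3).$$
   Context: $A\cdot B=\mathrm{tr}(A^TB)$, $|A|^2=A\cdot A$ (Frobenius norm), $\mathrm{cof}\,A$ is the cofactor matrix of $A\in\mathbb{R}^{3\times3}$, and $\chi_\omega$ is the characteristic function of $\omega$. *)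

(* Defs.v *)
From HB Require Import structures.
From mathcomp Require Import all_boot all_order all_algebra.
From mathcomp Require Import all_classical all_reals all_analysis.
Import Order.TTheory GRing.Theory Num.Theory.
Import numFieldNormedType.Exports.

Set Implicit Arguments.
Unset Strict Implicit.
Unset Printing Implicit Defensive.

Local Open Scope classical_set_scope.
Local Open Scope ring_scope.

Section matrices.
Context {R : realType}.

Definition frob (m n : nat) (A B : 'M[R]_(m, n)) : R := \tr (A^T *m B).

Definition fnorm (m n : nat) (A : 'M[R]_(m, n)) : R := Num.sqrt (frob A A).

Definition cofmx (n : nat) (A : 'M[R]_n) : 'M[R]_n :=
  \matrix_(i, j) cofactor A i j.

End matrices.

(* R^3 is the iterated product R * R * R, which carries both the product
   topology and normed structure and the product (Borel) sigma-algebra. *)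
Notation R3 R := (R * R * R)%type.

Definition borel_lebesgue3 {R : realType} : set _ -> \bar R :=
  ((@lebesgue_measure R \x @lebesgue_measure R) \x @lebesgue_measure R)%E.
HB.instance Definition _ (R : realType) := Measure.on (@borel_lebesgue3 R).

(* The points of [LR3 R] are those of [R3 R], but its measurable sets
   are all the Lebesgue measurable ones: [lebesgue3] is the Caratheodory
   completion of the product measure. *)
Notation LR3 R := (caratheodory_type ((@borel_lebesgue3 R)^*)%mu).

Definition lebesgue3 {R : realType} : set (LR3 R) -> \bar R :=
  @completed_measure_extension _ _ _ (@borel_lebesgue3 R).
HB.instance Definition _ (R : realType) := Measure.on (@lebesgue3 R).

Section smooth.
Context {R : realType}.

Definition basis3 (j : 'I_3) : R3 R :=
  ((j == 0 :> nat)%:R, (j == 1 :> nat)%:R, (j == 2 :> nat)%:R).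

Definition partial (j : 'I_3) (f : R3 R -> R) : R3 R -> R :=
  fun x => 'D_(basis3 j) f x.

(* All iterated partial derivatives exist everywhere and are continuous. *)
Definition smooth (f : R3 R -> R) : Prop :=
  forall s : seq 'I_3, let g := foldr partial f s in
    continuous g /\ forall x j, derivable g x (basis3 j).

(* C_c^oo(Omega), its elements being extended by 0 to the whole space. *)
Definition Ccoo (Omega : set (R3 R)) (f : R3 R -> R) : Prop :=
  let supp := closure [set x | f x != 0] in
  [/\ smooth f, compact supp & supp `<=` Omega].

Definition Ccoo3 (Omega : set (R3 R)) (u : R3 R -> 'cV[R]_3) : Prop :=
  forall i, Ccoo Omega (fun x => u x i 0).

Definition grad (u : R3 R -> 'cV[R]_3) (x : R3 R) : 'M[R]_3 :=
  \matrix_(i, j) partial j (fun y => u y i 0) x.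

End smooth.

Section sobolev.
Context {R : realType}.
Local Notation mu := (@lebesgue3 R).

Definition is_domain (Omega : set (R3 R)) : Prop :=
  [/\ open Omega, connected Omega & Omega !=set0].

Definition L2 (Omega : set (R3 R)) (m n : nat)
    (f : R3 R -> 'M[R]_(m, n)) : Prop :=
  (forall i j, measurable_fun (Omega : set (LR3 R))
                 (fun x : LR3 R => f x i j)) /\
  (\int[mu]_(x in Omega) (fnorm (f x) ^+ 2)%:E < +oo)%E.

Definition weak_grad (Omega : set (R3 R)) (u : R3 R -> 'cV[R]_3)
    (Du : R3 R -> 'M[R]_3) : Prop :=
  forall phi, Ccoo Omega phi -> forall i j : 'I_3,
    (\int[mu]_(x in Omega) (u x i 0 * partial j phi x)%:E =
     - \int[mu]_(x in Omega) (Du x i j * phi x)%:E)%E.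

(* [H1 Omega u Du]: u is in H^1(Omega; R^3) and Du represents its weak
   gradient (unique up to a null set). *)
Definition H1 (Omega : set (R3 R)) (u : R3 R -> 'cV[R]_3)
    (Du : R3 R -> 'M[R]_3) : Prop :=
  [/\ L2 Omega u, L2 Omega Du & weak_grad Omega u Du].

(* Closure of C_c^oo(Omega; R^3) for the H^1 norm. *)
Definition H10 (Omega : set (R3 R)) (u : R3 R -> 'cV[R]_3)
    (Du : R3 R -> 'M[R]_3) : Prop :=
  H1 Omega u Du /\
  exists phi : nat -> R3 R -> 'cV[R]_3,
    (forall n, Ccoo3 Omega (phi n)) /\
    (fun n => \int[mu]_(x in Omega) (fnorm (u x - phi n x) ^+ 2 +
        fnorm (Du x - grad (phi n) x) ^+ 2)%:E)%E @ \oo --> 0%E.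

(* The functional, in terms of the gradient field Du of u. *)
Definition Ftilde (Omega : set (R3 R)) (T : R3 R -> 'M[R]_3)
    (Du : R3 R -> 'M[R]_3) : \bar R :=
  (\int[mu]_(x in Omega)
     (fnorm (Du x) ^+ 2 + frob (T x) (cofmx (Du x)))%:E)%E.

End sobolev.

(* Main.v *)
Require Import Defs.
From HB Require Import structures.
From mathcomp Require Import all_boot all_order all_algebra.
From mathcomp Require Import ring lra.
From mathcomp Require Import all_classical all_reals all_analysis.
From mathcomp Require Import measurable_realfun.
Import Order.TTheory GRing.Theory Num.Theory.
Import numFieldNormedType.Exports.

(** The cofactor matrix of a gradient is a null Lagrangian: when u vanishes on
    the boundary of Omega, the integral of every entry of [cof (grad u)] over
    Omega is 0.  Hence nothing changes if the weight [\1_omega] in front of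
    [T0 . cof (grad u)] is replaced by [\1_omega - 1/2], whose modulus is 1/2
    everywhere.  For 3 x 3 matrices [|cof A| <= |A|^2 / sqrt 3]
    ([sqr_fnorm_cofmx]), so by the Cauchy-Schwarz inequality the new integrand is
    at least [(1 - |T0| / (2 sqrt 3)) |grad u|^2].  This gives both claims, with
    [gamma = 1 - |T0| / (2 sqrt 3)] in the second one; the argument is
    [coercive_of_null_lagrangian].

    For test functions the null Lagrangian property ([integral_cofmx_grad]) holds
    because a cofactor [d_j f d_k g - d_k f d_j g] is the divergence
    [d_j (f d_k g) - d_k (f d_j g)]: mixed derivatives commute
    ([mixed_derivatives_eq]), and a partial derivative of a function with compact
    support integrates to 0 along every line in its direction, hence over the
    space by Fubini's theorem ([integral_partial]).  Fubini's theorem concerns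
    the product measure; [integral_lebesgue3] transfers its consequences to the
    completed measure.

    For H^1_0 functions the property follows by approximation
    ([integral_cofmx_closure]): the cofactor is a quadratic function of the
    matrix, so its integral is continuous for the L2 norm of the gradient. *)

Set Implicit Arguments.
Unset Strict Implicit.
Unset Printing Implicit Defensive.

Local Open Scope classical_set_scope.
Local Open Scope ring_scope.

(** * Pointwise bounds on the cofactor matrix *)

Section matrices.
Context {R : realType}.

Lemma frobE m n (A B : 'M[R]_(m, n)) :
  frob A B = \sum_i \sum_j A i j * B i j.
Proof.
rewrite /frob /mxtrace exchange_big; apply: eq_bigr => j _; rewrite mxE.
by apply: eq_bigr => i _; rewrite mxE.
Qed.

Lemma frob_ge0 m n (A : 'M[R]_(m, n)) : 0 <= frob A A.
Proof.
by rewrite frobE; do 2 apply: sumr_ge0 => ? _; rewrite -expr2 sqr_ge0.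
Qed.

Lemma fnorm_ge0 m n (A : 'M[R]_(m, n)) : 0 <= fnorm A.
Proof. exact: sqrtr_ge0. Qed.

Lemma sqr_fnorm m n (A : 'M[R]_(m, n)) : fnorm A ^+ 2 = frob A A.
Proof. by rewrite sqr_sqrtr ?frob_ge0. Qed.

Lemma sqr_fnormE m n (A : 'M[R]_(m, n)) :
  fnorm A ^+ 2 = \sum_i \sum_j A i j ^+ 2.
Proof. by rewrite sqr_fnorm frobE; do 2 apply: eq_bigr => ? _. Qed.

Lemma sqr_entry_le m n (A : 'M[R]_(m, n)) i j : A i j ^+ 2 <= fnorm A ^+ 2.
Proof.
rewrite sqr_fnormE (bigD1 i)//= (bigD1 j)//= -addrA lerDl.
by rewrite addr_ge0 ?sumr_ge0// => *; rewrite ?sumr_ge0// => *; rewrite sqr_ge0.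
Qed.

(** The discriminant argument: [|A - tB|^2 >= 0] at the minimizer
    [t = (A . B) / |B|^2]. *)
Lemma frob_cauchy_schwarz m n (A B : 'M[R]_(m, n)) :
  `|frob A B| <= fnorm A * fnorm B.
Proof.
have AB0 t : 0 <= frob A A - frob A B *+ 2 * t + frob B B * t ^+ 2.
  rewrite [leRHS](_ : _ = frob (A - t *: B) (A - t *: B)) ?frob_ge0//.
  rewrite !frobE mulrnAl -mulrnAr !mulr_suml -sumrB -big_split; apply: eq_bigr => i _ /=.
  rewrite !mulr_suml -sumrB -big_split; apply: eq_bigr => j _ /=.
  by rewrite !mxE; ring.
rewrite -(@ler_pXn2r _ 2)// ?nnegrE ?mulr_ge0 ?fnorm_ge0//.
rewrite exprMn !sqr_fnorm real_normK ?num_real//.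
have := frob_ge0 B; rewrite le_eqVlt => /predU1P[B0|B_gt0]; last first.
  have B'0 : frob B B != 0 by rewrite gt_eqF.
  rewrite -subr_ge0.
  have := mulr_ge0 (AB0 (frob A B / frob B B)) (ltW B_gt0).
  by congr (_ <= _); field.
rewrite -B0 mulr0 (_ : frob A B = 0) ?expr0n// frobE.
rewrite big1// => i _; rewrite big1// => j _.
have : B i j ^+ 2 <= 0 by rewrite B0 -sqr_fnorm sqr_entry_le.
by rewrite le_eqVlt ltNge sqr_ge0 orbF sqrf_eq0 => /eqP ->; rewrite mulr0.
Qed.

(** Indexing the two remaining rows and columns by [lift] treats all nine
    cofactors uniformly, which spares the integration by parts a case
    distinction. *)
Lemma cofmx3E (A : 'M[R]_3) i j : cofmx A i j = (-1) ^+ (i + j) *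
  (A (lift i ord0) (lift j ord0) * A (lift i ord_max) (lift j ord_max) -
   A (lift i ord0) (lift j ord_max) * A (lift i ord_max) (lift j ord0)).
Proof.
rewrite mxE /cofactor; congr (_ * _).
rewrite (expand_det_row _ ord0) !big_ord_recl big_ord0 addr0 /cofactor.
rewrite /= !det_mx11 !mxE /= expr0 mul1r expr1 mulN1r mulrN.
have e1 : lift (ord0 : 'I_2) (0 : 'I_1) = ord_max by apply/val_inj.
have e2 : lift (ord_max : 'I_2) (0 : 'I_1) = ord0 by apply/val_inj.
have e3 : lift (ord0 : 'I_2) (ord0 : 'I_1) = ord_max by apply/val_inj.
by rewrite ?e3 ?e1 ?e2.
Qed.

(** The rows of the cofactor matrix are the cross products of the rows a, b, c
    of A.  By Lagrange's identity its squared norm is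
    [|a|^2|b|^2 + |b|^2|c|^2 + |c|^2|a|^2] minus the squares of the scalar
    products, and [3 (xy + yz + zx) <= (x + y + z)^2]. *)
Lemma sqr_fnorm_cofmx (A : 'M[R]_3) :
  3 * fnorm (cofmx A) ^+ 2 <= (fnorm A ^+ 2) ^+ 2.
Proof.
rewrite !sqr_fnormE !big_ord_recl !big_ord0 !addr0 !cofmx3E.
rewrite !exprMn !sqrr_sign !mul1r.
pose o0 : 'I_3 := ord0; pose o1 : 'I_3 := lift ord0 ord0.
pose o2 : 'I_3 := lift ord0 (lift ord0 ord0).
have l02 : lift o0 ord_max = o2 by exact/val_inj.
have l10 : lift o1 ord0 = o0 by exact/val_inj.
have l12 : lift o1 ord_max = o2 by exact/val_inj.
have l20 : lift o2 ord0 = o0 by exact/val_inj.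
have l21 : lift o2 ord_max = o1 by exact/val_inj.
rewrite -/o0 -/o1 -/o2 !(l02, l10, l12, l20, l21).
pose dot i j := A i o0 * A j o0 + A i o1 * A j o1 + A i o2 * A j o2.
rewrite -subr_ge0 [leRHS](_ : _ = 2^-1 * ((dot o0 o0 - dot o1 o1) ^+ 2 +
  (dot o1 o1 - dot o2 o2) ^+ 2 + (dot o2 o2 - dot o0 o0) ^+ 2) +
  3 * (dot o0 o1 ^+ 2 + dot o1 o2 ^+ 2 + dot o2 o0 ^+ 2)).
  by rewrite addr_ge0// mulr_ge0// !addr_ge0// sqr_ge0.
by rewrite /dot; field.
Qed.

(** This is where the constant [2 sqrt 3] of the theorem comes from: half of the
    right-hand side is at most [|A|^2] as soon as [|T| <= 2 sqrt 3]. *)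
Lemma frob_cofmx_le (T A : 'M[R]_3) :
  `|frob T (cofmx A)| <= fnorm T / Num.sqrt 3 * fnorm A ^+ 2.
Proof.
apply: (le_trans (frob_cauchy_schwarz _ _)).
rewrite -mulrA; apply: ler_wpM2l; first exact: fnorm_ge0.
rewrite [leRHS]mulrC ler_pdivlMr ?sqrtr_gt0//.
rewrite -(@ler_pXn2r _ 2)// ?nnegrE ?mulr_ge0 ?fnorm_ge0 ?sqrtr_ge0 ?sqr_ge0//.
by rewrite exprMn (sqr_sqrtr (ler0n R 3)) mulrC sqr_fnorm_cofmx.
Qed.

Lemma norm_cofmx_le (A : 'M[R]_3) i j : `|cofmx A i j| <= fnorm A ^+ 2.
Proof.
rewrite -(@ler_pXn2r _ 2)// ?nnegrE ?sqr_ge0// real_normK ?num_real//.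
apply: (le_trans (sqr_entry_le _ i j)); apply: le_trans (sqr_fnorm_cofmx A).
by rewrite ler_peMl ?sqr_ge0// ler1n.
Qed.

Lemma norm_mul_young (eps P Q d q : R) : 0 < eps -> q ^+ 2 <= P ->
  d ^+ 2 <= Q -> `|d * q| <= 2^-1 * (eps * P + eps^-1 * Q).
Proof.
move=> e0 qP dQ; have e0' : 0 < eps^-1 by rewrite invr_gt0.
apply: (@le_trans _ _ (2^-1 * (eps * q ^+ 2 + eps^-1 * d ^+ 2))); last first.
  by rewrite ler_pM2l ?invr_gt0// lerD// ler_pM2l.
have sq t : 0 <= eps^-1 * (eps * q + t * d) ^+ 2.
  by rewrite mulr_ge0 ?sqr_ge0// ltW.
have e1 : eps != 0 by rewrite gt_eqF.
rewrite ler_norml; apply/andP; split; rewrite -subr_ge0.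
  have := mulr_ge0 (_ : 0 <= 2^-1) (sq 1); rewrite invr_ge0 ler0n => /(_ isT).
  by congr (_ <= _); field.
have := mulr_ge0 (_ : 0 <= 2^-1) (sq (-1)); rewrite invr_ge0 ler0n => /(_ isT).
by congr (_ <= _); field.
Qed.

(** Quadratic maps are continuous in mean square.  The weight [eps] makes the
    term in [A] small, which replaces Hoelder's inequality in the passage to the
    limit. *)
Lemma norm_cofmxB (A B : 'M[R]_3) (eps : R) i j : 0 < eps ->
  `|cofmx A i j - cofmx B i j| <=
  2 * (eps * fnorm A ^+ 2 + (eps^-1 + 1) * fnorm (A - B) ^+ 2).
Proof.
move=> e0; rewrite !cofmx3E -mulrBr normrM normrX normrN1 expr1n mul1r.
set i0 := lift i ord0; set i1 := lift i ord_max.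
set j0 := lift j ord0; set j1 := lift j ord_max.
have EE k l : B k l = A k l - (A - B) k l by rewrite !mxE; ring.
have AP k l := sqr_entry_le A k l; have EQ k l := sqr_entry_le (A - B) k l.
have AE k l m n := norm_mul_young e0 (AP k l) (EQ m n).
have QQ k l m n := norm_mul_young ltr01 (EQ k l) (EQ m n).
rewrite !EE; set E := A - B in AE QQ *.
move: (fnorm A ^+ 2) (fnorm E ^+ 2) AE QQ => P Q AE QQ {EE AP EQ}.
(* with B = A - E, each term of the difference has a factor from E *)
rewrite [X in `|X|](_ : _ = E i0 j0 * A i1 j1 + E i1 j1 * A i0 j0
   - E i0 j0 * E i1 j1 - E i0 j1 * A i1 j0 - E i1 j0 * A i0 j1
   + E i0 j1 * E i1 j0); last by ring.
have := AE i1 j1 i0 j0; have := AE i0 j0 i1 j1; have := AE i1 j0 i0 j1.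
have := AE i0 j1 i1 j0; have := QQ i1 j1 i0 j0; have := QQ i1 j0 i0 j1.
rewrite !ler_norml => /andP[? ?] /andP[? ?] /andP[? ?] /andP[? ?] /andP[? ?] /andP[? ?].
by apply/andP; split; lra.
Qed.
End matrices.

(** * Integrals of cofactors of square integrable matrix fields *)

Section square_integrable.
Context d (T : measurableType d) (R : realType).
Variables (mu : {measure set T -> \bar R}) (D : set T) (mD : measurable D).

(** For [lebesgue3] and [D = Omega] this is [L2 Omega]; the estimates below hold
    over any measure space. *)
Definition square_integrable m n (A : T -> 'M[R]_(m, n)) : Prop :=
  (forall i j, measurable_fun D (fun x => A x i j)) /\
  (\int[mu]_(x in D) (fnorm (A x) ^+ 2)%:E < +oo)%E.

Lemma measurable_sqr_fnorm m n (A : T -> 'M[R]_(m, n)) :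
  (forall i j, measurable_fun D (fun x => A x i j)) ->
  measurable_fun D (fun x => fnorm (A x) ^+ 2).
Proof.
move=> mA; under eq_fun do rewrite sqr_fnormE.
by apply: measurable_sum => i; apply: measurable_sum => j; exact: measurable_funX.
Qed.

Lemma measurable_cofmx (A : T -> 'M[R]_3) i j :
  (forall i j, measurable_fun D (fun x => A x i j)) ->
  measurable_fun D (fun x => cofmx (A x) i j).
Proof.
move=> mA; under eq_fun do rewrite cofmx3E.
apply: measurable_funM; first exact: measurable_cst.
by apply: measurable_funB; apply: measurable_funM.
Qed.

Lemma square_integrableP m n (A : T -> 'M[R]_(m, n)) : square_integrable A ->
  mu.-integrable D (EFin \o (fun x => fnorm (A x) ^+ 2)).
Proof.
move=> [mA fA]; apply/integrableP; split.
  exact/measurable_EFinP/measurable_sqr_fnorm.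
by under eq_integral do rewrite gee0_abs ?lee_fin ?sqr_ge0//.
Qed.

Lemma integrable_cofmx (A : T -> 'M[R]_3) i j : square_integrable A ->
  mu.-integrable D (EFin \o (fun x => cofmx (A x) i j)).
Proof.
move=> sA; apply: (le_integrable _ _ _ (square_integrableP sA)) => //.
  by apply/measurable_EFinP/measurable_cofmx; case: sA.
move=> x _ /=; rewrite lee_fin [leRHS]ger0_norm ?sqr_ge0//.
exact: norm_cofmx_le.
Qed.

Lemma integrable_frob_cofmx (S : 'M[R]_3) (A : T -> 'M[R]_3) :
  square_integrable A ->
  mu.-integrable D (EFin \o (fun x => frob S (cofmx (A x)))).
Proof.
move=> sA; rewrite [X in mu.-integrable _ X](_ : _ = fun x => (\sum_i \sum_j
  (S i j)%:E * (cofmx (A x) i j)%:E)%E); last first.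
  apply/funext => x; rewrite /= frobE -sumEFin; apply: eq_bigr => i _.
  by rewrite -sumEFin; apply: eq_bigr => j _; rewrite EFinM.
apply: integrable_sum => // i _; apply: integrable_sum => // j _.
by apply: integrableZl => //; exact: integrable_cofmx.
Qed.

Lemma integral_frob_cofmx (S : 'M[R]_3) (A : T -> 'M[R]_3) :
  square_integrable A ->
  (forall i j, \int[mu]_(x in D) (cofmx (A x) i j)%:E = 0)%E ->
  (\int[mu]_(x in D) (frob S (cofmx (A x)))%:E = 0)%E.
Proof.
move=> sA A0.
have iA i j : mu.-integrable D (fun x => (S i j)%:E * (cofmx (A x) i j)%:E)%E.
  by apply: integrableZl => //; exact: integrable_cofmx.
rewrite (eq_integral (fun x => \sum_i \sum_j
  (S i j)%:E * (cofmx (A x) i j)%:E)%E); last first.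
  move=> x _; rewrite frobE -sumEFin; apply: eq_bigr => i _.
  by rewrite -sumEFin; apply: eq_bigr => j _; rewrite EFinM.
rewrite integral_sum//; last by move=> i; apply: integrable_sum.
apply: big1 => i _; rewrite integral_sum//; apply: big1 => j _.
by rewrite integralZl ?A0 ?mule0//; exact: integrable_cofmx.
Qed.

(** By [norm_cofmxB] the integral of a cofactor of A is at most
    [2 (t |A|^2 + (1/t + 1) |A - B|^2)] in L2 norms; choose t first and then B. *)
Lemma integral_cofmx_closure (A : T -> 'M[R]_3) i j : square_integrable A ->
  (forall eps : R, 0 < eps -> exists B, [/\ square_integrable B,
    \int[mu]_(x in D) (cofmx (B x) i j)%:E = 0 &
    \int[mu]_(x in D) (fnorm (A x - B x) ^+ 2)%:E < eps%:E]%E) ->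
  (\int[mu]_(x in D) (cofmx (A x) i j)%:E = 0)%E.
Proof.
move=> sA apx.
suff I0 : (\int[mu]_(x in D) (cofmx (A x) i j))%R = 0.
  rewrite -(fineK (integrable_fin_num mD (integrable_cofmx i j sA))).
  by congr (_%:E); exact: I0.
apply/eqP; rewrite -normr_le0; apply/ler_addgt0Pr => e e0; rewrite add0r.
set a := (\int[mu]_(x in D) (fnorm (A x) ^+ 2))%R.
have a0 : 0 <= a by apply: Rintegral_ge0 => x _; rewrite sqr_ge0.
pose t : R := e / (4 * (a + 1)).
have t0 : 0 < t by rewrite divr_gt0// mulr_gt0// ltr_wpDl.
have t1 : 0 < t^-1 + 1 by rewrite addr_gt0// invr_gt0.
have [|B [sB B0 AB]] := apx (e / (4 * (t^-1 + 1))); first by rewrite divr_gt0// mulr_gt0.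
have sAB : square_integrable (fun x => A x - B x).
  split; last by rewrite (lt_trans AB)// ltry.
  move=> k l; under eq_fun do rewrite !mxE.
  by apply: measurable_funB; [exact: sA.1|exact: sB.1].
set b := (\int[mu]_(x in D) (fnorm (A x - B x) ^+ 2))%R.
have be : b < e / (4 * (t^-1 + 1)).
  by rewrite -lte_fin fineK//; exact: integrable_fin_num (square_integrableP sAB).
have iA := square_integrableP sA; have iAB := square_integrableP sAB.
have cA := integrable_cofmx i j sA; have cB := integrable_cofmx i j sB.
have iAt : mu.-integrable D (EFin \o (fun x => t * fnorm (A x) ^+ 2)).
  exact: (integrableZl mD t iA).
have iABt : mu.-integrable D (EFin \o (fun x => (t^-1 + 1) * fnorm (A x - B x) ^+ 2)).
  exact: (integrableZl mD (t^-1 + 1) iAB).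
have iS : mu.-integrable D (EFin \o (fun x => t * fnorm (A x) ^+ 2 +
    (t^-1 + 1) * fnorm (A x - B x) ^+ 2)).
  exact: (integrableD mD iAt iABt).
have iS2 : mu.-integrable D (EFin \o (fun x => 2 * (t * fnorm (A x) ^+ 2 +
    (t^-1 + 1) * fnorm (A x - B x) ^+ 2))).
  exact: (integrableZl mD 2 iS).
have icAB : mu.-integrable D (EFin \o (fun x => cofmx (A x) i j - cofmx (B x) i j)).
  exact: (integrableB mD cA cB).
have -> : (\int[mu]_(x in D) (cofmx (A x) i j))%R =
    (\int[mu]_(x in D) (cofmx (A x) i j - cofmx (B x) i j))%R.
  by rewrite RintegralB// [X in _ - X](_ : _ = 0) ?subr0// /Rintegral B0.
apply: (le_trans (le_normr_Rintegral mD icAB)).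
apply: (@le_trans _ _ (2 * (t * a + (t^-1 + 1) * b))).
  rewrite -!RintegralZl// -RintegralD// -RintegralZl//.
  apply: le_Rintegral => //; first exact: integrable_norm.
  by move=> x _; exact: norm_cofmxB.
have ta : t * a <= e / 4.
  rewrite /t mulrAC ler_pdivrMr ?mulr_gt0 ?ltr_wpDl// mulrA divfK//.
  by apply: ler_wpM2l; [exact: ltW|rewrite lerDl].
have tb : (t^-1 + 1) * b <= e / 4.
  move: be; rewrite ltr_pdivlMr ?mulr_gt0// ler_pdivlMr// => /ltW.
  by congr (_ <= _); ring.
by move: ta tb; lra.
Qed.

(** The key estimate.  As [S . cof A] has zero integral, half of it can be
    subtracted from the integrand, which replaces the weight [\1_om], with values
    0 and 1, by [\1_om - 1/2], of modulus 1/2.  The pointwise bound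
    [frob_cofmx_le] then applies with half of its constant. *)
Lemma coercive_of_null_lagrangian (A : T -> 'M[R]_3) (om : set T) (S : 'M[R]_3) :
  measurable om -> square_integrable A ->
  (forall i j, \int[mu]_(x in D) (cofmx (A x) i j)%:E = 0)%E ->
  ((1 - fnorm S / (2 * Num.sqrt 3))%:E *
     \int[mu]_(x in D) (fnorm (A x) ^+ 2)%:E <=
   \int[mu]_(x in D)
     (fnorm (A x) ^+ 2 + frob (\1_om x *: S) (cofmx (A x)))%:E)%E.
Proof.
move=> mom sA A0.
have iA := square_integrableP sA; have iq := integrable_frob_cofmx S sA.
have q0 := integral_frob_cofmx S sA A0.
set c := fnorm S / (2 * Num.sqrt 3).
have frobZ x : frob (\1_om x *: S) (cofmx (A x)) =
    \1_om x * frob S (cofmx (A x)).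
  rewrite !frobE mulr_sumr; apply: eq_bigr => k _.
  by rewrite mulr_sumr; apply: eq_bigr => l _; rewrite mxE mulrA.
set q := fun x => frob S (cofmx (A x)); set a := fun x => fnorm (A x) ^+ 2.
have iq2 : mu.-integrable D (EFin \o (fun x => 2^-1 * q x)).
  exact: (integrableZl mD 2^-1 iq).
have iqom : mu.-integrable D (EFin \o (fun x => \1_om x * q x)).
  apply: (le_integrable mD _ _ iq).
    apply/measurable_EFinP/measurable_funM; first exact: measurable_indic.
    exact/measurable_EFinP/(measurable_int mu).
  move=> x _; rewrite /= lee_fin normrM ler_piMl// indicE.
  by case: (_ \in _); rewrite ?normr0 ?normr1.
have iL : mu.-integrable D (EFin \o (fun x => a x + \1_om x * q x)).
  exact: (integrableD mD iA iqom).
have iL2 : mu.-integrable D (EFin \o (fun x => a x + \1_om x * q x - 2^-1 * q x)).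
  exact: (integrableB mD iL iq2).
have ica : mu.-integrable D (EFin \o (fun x => (1 - c) * a x)).
  exact: (integrableZl mD (1 - c) iA).
(* subtract half of the null Lagrangian under the integral sign *)
have -> : (\int[mu]_(x in D)
     (fnorm (A x) ^+ 2 + frob (\1_om x *: S) (cofmx (A x)))%:E =
   \int[mu]_(x in D) (a x + \1_om x * q x - 2^-1 * q x)%:E)%E.
  under [RHS]eq_integral do rewrite EFinB.
  rewrite integralB_EFin//; under [X in (_ - X)%E]eq_integral do rewrite EFinM.
  rewrite integralZl// q0 mule0 sube0.
  by apply: eq_integral => x _; rewrite frobZ.
rewrite -integralZl//; apply: (le_integral mD ica iL2).
move=> x _; rewrite /= lee_fin.
have := frob_cofmx_le S (A x).
rewrite -/(a x) -/(q x) [fnorm S / _](_ : _ = 2 * c); last first.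
  by rewrite /c; field; rewrite gt_eqF// sqrtr_gt0.
rewrite ler_norml => /andP[].
by rewrite indicE; case: (_ \in _) => /=; lra.
Qed.

End square_integrable.

(** * Borel and Lebesgue measurability on the three-dimensional space *)

(** The points of [R3 R], with the Borel sigma-algebra on which
    [borel_lebesgue3] lives. *)
Notation BR R := (measurableTypeR R).
Notation BR3 R := (BR R * BR R * BR R)%type.

Section lebesgue2.
Context {R : realType}.
Local Notation mu := (@lebesgue_measure R).

(** The plane measure is named in order to carry its sigma-finiteness, which
    Fubini's theorem requires of the factors of [lebesgue2 \x mu]. *)
Definition lebesgue2 : set (BR R * BR R) -> \bar R := (mu \x mu)%E.

HB.instance Definition _ := Measure.on lebesgue2.

Lemma lebesgue_measure_symmetric_itv (M : R) : (mu `[(- M)%R, M] < +oo)%E.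
Proof. by rewrite lebesgue_measure_itv/=; case: ifP => _; rewrite -?EFinD ltry. Qed.

Lemma lebesgue2_square (M : R) :
  (lebesgue2 (`[(- M)%R, M] `*` `[(- M)%R, M]) < +oo)%E.
Proof.
rewrite /lebesgue2 product_measure1E//; apply: lte_mul_pinfty => //.
  by rewrite ge0_fin_numE// lebesgue_measure_symmetric_itv.
exact: lebesgue_measure_symmetric_itv.
Qed.

Lemma lebesgue2_sigma_finite : sigma_finite setT lebesgue2.
Proof.
exists (fun n => `[(- n%:R)%R, n%:R] `*` `[(- n%:R)%R, n%:R]); last first.
  by move=> n; split; [exact: measurableX|exact: lebesgue2_square].
apply/seteqP; split => // -[x y] _.
exists (Num.truncn (`|x| + `|y|)).+1 => //=.
have H : `|x| + `|y| < (Num.truncn (`|x| + `|y|)).+1%:R by exact: truncnS_gt.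
by split; rewrite /= in_itv/= -ler_norml; apply: le_trans (ltW H);
  rewrite (lerDl, lerDr).
Qed.

HB.instance Definition _ :=
  Measure_isSigmaFinite.Build _ _ _ lebesgue2 lebesgue2_sigma_finite.

End lebesgue2.

Section borel.
Context {R : realType}.
Local Notation mu := (@lebesgue_measure R).

Lemma near_rat (x e : R) : 0 < e -> exists q : rat, `|x - ratr q| < e.
Proof.
move=> e0; have [q] := @rat_in_itvoo R (x - e) (x + e) (ltac:(lra)).
rewrite in_itv/= => /andP[? ?]; exists q.
by rewrite ltr_norml; apply/andP; split; lra.
Qed.

(** The product topology has a countable basis of boxes with rational centre and
    half-width, and boxes belong to the product sigma-algebra. *)
Lemma open_measurable_R3 (U : set (R3 R)) : open U -> measurable (U : set (BR3 R)).
Proof.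
move=> oU.
pose box (a b c r : rat) : set (R3 R) :=
  ball (ratr a : R) (ratr r) `*` ball (ratr b : R) (ratr r) `*`
  ball (ratr c : R) (ratr r).
have mbox a b c r : measurable (box a b c r : set (BR3 R)).
  by apply: measurableX; [apply: measurableX|]; exact: measurable_ball.
suff -> : U = \bigcup_(a : rat) \bigcup_(b : rat) \bigcup_(c : rat)
    \bigcup_(r in [set r | box a b c r `<=` U]) box a b c r.
  apply: bigcupT_measurable_rat => a; apply: bigcupT_measurable_rat => b.
  apply: bigcupT_measurable_rat => c.
  rewrite bigcup_mkcond; apply: bigcupT_measurable_rat => r.
  by case: ifP => _.
apply/seteqP; split=> [[[x y] z] Uxyz|p]; last first.
  by case=> a _ [b _] [c _] [r bU]; exact: bU.
have /nbhs_ballP[e /= e0 eU] := open_nbhs_nbhs (conj oU Uxyz).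
have [r] := @rat_in_itvoo R 0 (e / 2) (ltac:(lra)).
rewrite in_itv/= => /andP[r0 re].
have [a xa] := near_rat x r0; have [b yb] := near_rat y r0.
have [c zc] := near_rat z r0.
exists a => //; exists b => //; exists c => //; exists r; last first.
  by split; [split|] => /=; rewrite /ball/= distrC.
move=> [[x' y'] z'] [[/= ax ay] az]; apply: eU.
have near (u : R) (q : rat) (v : R) : `|u - ratr q| < ratr r -> ball (ratr q : R) (ratr r) v ->
    ball u e v.
  rewrite /ball/= => uq qv; rewrite -(subrKA (ratr q)).
  by rewrite (le_lt_trans (ler_normD _ _))//; lra.
by split; [split|]; [exact: near xa _|exact: near yb _|exact: near zc _].
Qed.

Lemma continuous_measurable_R3 (f : R3 R -> R) :
  continuous f -> measurable_fun [set: BR3 R] f.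
Proof.
move=> /continuousP cf; apply: (measurability _ (RGenOpens.measurableE R)).
move=> _ [_ [a [b ->] <-]]; rewrite setTI; apply: open_measurable_R3.
exact/cf/interval_open.
Qed.

Lemma measurable_LR3 (A : set (R3 R)) :
  measurable (A : set (BR3 R)) -> measurable (A : set (LR3 R)).
Proof.
by move=> mA; apply: sub_caratheodory; exact: sub_sigma_algebra.
Qed.

Lemma measurable_fun_LR3 d (T : measurableType d) (D : set (R3 R))
    (f : R3 R -> T) : measurable_fun [set: BR3 R] f ->
  measurable_fun (D : set (LR3 R)) (f : LR3 R -> T).
Proof.
move=> mf; apply: (@measurable_funTS _ _ (LR3 R)) => _ Y mY.
by rewrite setTI; apply: measurable_LR3; rewrite -[X in measurable X]setTI; exact: mf.
Qed.

(** The identity from [LR3 R] to [BR3 R] is measurable, and the completed measure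
    extends the product measure, which is therefore the image of the former on
    Borel sets. *)
Lemma integral_lebesgue3 (f : R3 R -> \bar R) :
  measurable_fun [set: BR3 R] f ->
  (\int[lebesgue3]_x f x = \int[lebesgue2 \x mu]_x f x)%E.
Proof.
move=> mf.
have mid : measurable_fun [set: LR3 R] (id : LR3 R -> BR3 R).
  by move=> _ Y mY; rewrite setTI; exact: measurable_LR3.
have ge0 (g : R3 R -> \bar R) : measurable_fun [set: BR3 R] g ->
    (forall x, 0 <= g x)%E ->
    (\int[lebesgue3]_x g x = \int[lebesgue2 \x mu]_x g x)%E.
  move=> mg g0.
  have := @ge0_integral_pushforward _ _ _ _ R _ mid lebesgue3 setT g.
  rewrite preimage_setT => <-//.
  apply: eq_measure_integral => A mA _.
  exact: measurable_mu_extE.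
rewrite integralE [RHS]integralE !ge0//.
  exact: measurable_funeneg.
exact: measurable_funepos.
Qed.

End borel.

(** * Mixed derivatives and integrals of derivatives *)

Section derivative_along_line.
Context {R : realType} {V : normedModType R}.
Implicit Types (f : V -> R) (p u v : V).

Lemma line_growth_rate f p v (t : R) :
  (fun h : R => h^-1 *: (((fun s : R => f (s *: v + p)) \o shift t) (h *: (1 : R)) -
     f (t *: v + p))) =
  (fun h : R => h^-1 *: ((f \o shift (t *: v + p)) (h *: v) - f (t *: v + p))).
Proof.
apply/funext => h /=; congr (_ *: (f _ - _)).
by rewrite [h *: 1]mulr1 scalerDl addrA.
Qed.

Lemma is_derive_line f p v (t : R) : derivable f (t *: v + p) v ->
  is_derive t 1 (fun s : R => f (s *: v + p)) ('D_v f (t *: v + p)).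
Proof.
move=> df; apply: DeriveDef; rewrite /derivable /derive line_growth_rate//.
Qed.

(** The mean value theorem applied twice: first along u to the difference of f
    between two parallel lines, then along v to its derivative. *)
Lemma second_difference_MVT f (Du Duv : V -> R) p u v (h : R) : 0 < h ->
  (forall x, is_derive x u f (Du x)) -> (forall x, is_derive x v Du (Duv x)) ->
  exists s t, [/\ 0 < s < h, 0 < t < h &
    f (h *: u + (h *: v + p)) - f (h *: u + p) - f (h *: v + p) + f p =
    Duv (t *: v + (s *: u + p)) * h ^+ 2].
Proof.
move=> h0 df dDu.
pose g s := f (s *: u + (h *: v + p)) - f (s *: u + p).
have dg (s : R) : is_derive s 1 g (Du (s *: u + (h *: v + p)) - Du (s *: u + p)).
  have D q : is_derive s 1 (fun s : R => f (s *: u + q)) (Du (s *: u + q)).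
    by have [? <-] := df (s *: u + q); exact: is_derive_line.
  exact: is_deriveB.
have cg : continuous g.
  by move=> s; apply/differentiable_continuous/derivable1_diffP; have [] := dg s.
have [s] := MVT h0 (fun s _ => dg s) (continuous_subspaceT cg).
rewrite in_itv/= => sh; rewrite /g !scale0r !add0r subr0 => gs.
pose k t := Du (t *: v + (s *: u + p)).
have dk (t : R) : is_derive t 1 k (Duv (t *: v + (s *: u + p))).
  by have [? <-] := dDu (t *: v + (s *: u + p)); exact: is_derive_line.
have ck : continuous k.
  by move=> t; apply/differentiable_continuous/derivable1_diffP; have [] := dk t.
have [t] := MVT h0 (fun t _ => dk t) (continuous_subspaceT ck).
rewrite in_itv/= => th; rewrite /k scale0r add0r subr0 => kt.
exists s, t; split=> //; rewrite expr2 mulrA -kt (addrCA (h *: v)) -gs.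
by ring.
Qed.

(** The second difference is symmetric in u and v, so both mixed derivatives,
    taken at suitable points near p, agree; conclude by continuity. *)
Lemma mixed_derivatives_eq f (Du Dv Duv Dvu : V -> R) u v p :
  (forall x, is_derive x u f (Du x)) -> (forall x, is_derive x v f (Dv x)) ->
  (forall x, is_derive x v Du (Duv x)) -> (forall x, is_derive x u Dv (Dvu x)) ->
  {for p, continuous Duv} -> {for p, continuous Dvu} -> Duv p = Dvu p.
Proof.
move=> du dv duv dvu cuv cvu; apply/eqP; rewrite -subr_eq0 -normr_le0.
apply/ler_addgt0Pr => e e0; rewrite add0r.
have e20 : 0 < e / 2 by rewrite divr_gt0.
have /cvgrPdist_lt/(_ _ e20) /nbhs_ballP[r1 /= r10 B1] := cuv.
have /cvgrPdist_lt/(_ _ e20) /nbhs_ballP[r2 /= r20 B2] := cvu.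
pose r := Num.min r1 r2; have r0 : 0 < r by rewrite lt_min r10.
(* any increment t v + s u with s, t < h = r / K stays in the ball of radius r *)
pose K := `|u| + `|v| + 1; have K0 : 0 < K by rewrite ltr_wpDl// addr_ge0.
pose h := r / K; have h0 : 0 < h by rewrite divr_gt0.
have near s t w1 w2 : 0 < s < h -> 0 < t < h -> `|w1| + `|w2| < K ->
    ball p r (t *: w1 + (s *: w2 + p)).
  move=> /andP[s0 sh] /andP[t0 th] wK; rewrite -ball_normE /ball_/=.
  rewrite addrA distrC addrK (le_lt_trans (ler_normD _ _))// !normrZ !gtr0_norm//.
  apply: (@le_lt_trans _ _ (h * (`|w1| + `|w2|))).
    by rewrite mulrDr lerD// ler_wpM2r// ltW.
  by rewrite -[ltRHS](divfK (lt0r_neq0 K0)) ltr_pM2l.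
have [s [t [sh th E1]]] := second_difference_MVT p h0 du duv.
have [s' [t' [sh' th' E2]]] := second_difference_MVT p h0 dv dvu.
have : Duv (t *: v + (s *: u + p)) =
       Dvu (t' *: u + (s' *: v + p)).
  apply: (@mulIf _ (h ^+ 2)); first by rewrite expf_neq0// gt_eqF.
  by rewrite -E1 -E2 (addrCA (h *: u)) -!addrA; congr (_ + _); rewrite addrCA.
have b1 : ball p r1 (t *: v + (s *: u + p)).
  by apply: le_ball (near _ _ _ _ sh th _); [rewrite ge_min lexx|rewrite /K; lra].
have b2 : ball p r2 (t' *: u + (s' *: v + p)).
  apply: le_ball (near _ _ _ _ sh' th' _); last by rewrite /K; lra.
  by rewrite ge_min lexx orbT.
move: (B1 _ b1) (B2 _ b2) => /= {}B1 {}B2 EE; move: B2; rewrite -EE distrC => B2.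
rewrite -(subrKA (Duv (t *: v + (s *: u + p)))).
by rewrite (le_trans (ler_normD _ _))// [leRHS](splitr e) ltW// ltrD.
Qed.

End derivative_along_line.

Section fundamental_theorem.
Context {R : realType}.
Local Notation mu := (@lebesgue_measure R).

(** The fundamental theorem of calculus on an interval at whose endpoints h
    vanishes. *)
Lemma integral_derive1_compact (h : R -> R) (M : R) :
  (forall t : R, derivable h t 1) -> continuous (derive1 h) ->
  (forall t : R, M < `|t| -> h t = 0) -> (\int[mu]_t (derive1 h t)%:E = 0)%E.
Proof.
move=> dh ch h0.
have h'0 (t : R) : M < `|t| -> derive1 h t = 0.
  move=> Mt; rewrite derive1E (@near_eq_derive _ _ _ h (cst 0) t) ?derive_cst//.
  apply/nbhs_ballP; exists (`|t| - M) => /= [|s]; first by rewrite subr_gt0.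
  rewrite /ball/= => ts; apply: h0.
  by have := ler_normD (t - s) s; rewrite subrK; lra.
pose b : R := `|M| + 1.
have Mb : M < b by rewrite /b ltr_pwDr// ler_norm.
have b0 : 0 < b by rewrite /b ltr_wpDl.
have -> : (\int[mu]_t (derive1 h t)%:E = \int[mu]_(t in `[(- b)%R, b]) (derive1 h t)%:E)%E.
  rewrite [RHS]integral_mkcond; apply: eq_integral => t _; rewrite patchE.
  case: ifPn => // /negP; rewrite inE/= in_itv/= -ler_norml => /negP.
  by rewrite -ltNge => bt; rewrite h'0// (lt_trans Mb).
have cont : continuous h.
  by move=> t; apply/differentiable_continuous/derivable1_diffP.
have ab : - b < b by rewrite gtrN.
have dFT : derivable_oo_LRcontinuous h (- b) b.
  split; [by move=> t _; exact: dh|exact/cvg_at_right_filter/cont|].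
  exact/cvg_at_left_filter/cont.
rewrite (continuous_FTC2 ab (continuous_subspaceT ch) dFT (fun _ _ => erefl)).
have hb : h b = 0 by apply: h0; rewrite gtr0_norm.
have hNb : h (- b) = 0 by apply: h0; rewrite normrN gtr0_norm.
by rewrite hb hNb subee.
Qed.

End fundamental_theorem.

(** * Integrals of partial derivatives over the space *)

Section divergence.
Context {R : realType}.
Local Notation mu := (@lebesgue_measure R).

Lemma integrable_bounded_support d (T : measurableType d)
    (nu : {measure set T -> \bar R}) (E : set T) (C : R) (f : T -> R) :
  measurable E -> (nu E < +oo)%E -> measurable_fun [set: T] f ->
  (forall x, `|f x| <= C) -> (forall x, ~ E x -> f x = 0) ->
  nu.-integrable [set: T] (EFin \o f).
Proof.
move=> mE nuE mf fC f0.
have -> : EFin \o f = (EFin \o f) \_ E.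
  apply/funext => x; rewrite patchE; case: ifPn => // /negP; rewrite inE => /f0.
  by move=> /= ->.
apply/(integrable_mkcond _ mE)/measurable_bounded_integrable => //.
  exact: measurable_funTS.
exists C; split; first exact: num_real.
by move=> M CM x _ /=; rewrite (le_trans (fC x))// ltW.
Qed.

Lemma integral_partial_line (G : R3 R -> R) j (p : R3 R) (M : R) :
  (forall x, derivable G x (basis3 j)) -> continuous (partial j G) ->
  (forall t : R, M < `|t| -> G (t *: basis3 j + p) = 0) ->
  (\int[mu]_t (partial j G (t *: basis3 j + p))%:E = 0)%E.
Proof.
move=> dG cG G0.
have dl (t : R) : is_derive t 1 (fun s : R => G (s *: basis3 j + p))
    (partial j G (t *: basis3 j + p)) by exact: is_derive_line.
have E : derive1 (fun s : R => G (s *: basis3 j + p)) =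
    fun t => partial j G (t *: basis3 j + p).
  by apply/funext => t; rewrite derive1E; have [_ ->] := dl t.
have dl1 (t : R) : derivable (fun s : R => G (s *: basis3 j + p)) t 1.
  by have [] := dl t.
have := integral_derive1_compact dl1 _ G0; rewrite E; apply.
move=> t; apply: continuous_comp; last exact: cG.
by apply: cvgD; [exact: scalel_continuous|exact: cvg_cst].
Qed.

Lemma compact_in_box (K : set (R3 R)) : compact K ->
  exists M : R, forall x y z, K (x, y, z) -> [/\ `|x| <= M, `|y| <= M & `|z| <= M].
Proof.
move=> /compact_bounded[M [_ /(_ (M + 1)) KM]]; exists (M + 1) => x y z Kxyz.
have := KM (ltac:(by rewrite ltrDl)) _ Kxyz.
by rewrite /= !prod_normE/= !ge_max => /andP[/andP[]].
Qed.

(** The sections with the last coordinate fixed are included because iterating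
    Fubini's theorem needs integrability on each horizontal plane, and not only
    on almost all of them. *)
Lemma continuous_compact_integrable3 (K : set (R3 R)) (f : R3 R -> R) :
  compact K -> continuous f -> (forall x, ~ K x -> f x = 0) ->
  (lebesgue2 \x mu)%E.-integrable [set: BR3 R] (EFin \o f) /\
  forall z, lebesgue2.-integrable setT (fun q => (f (q, z))%:E).
Proof.
move=> cK cf f0; have [M KM] := compact_in_box cK.
have [C fC] : exists C, forall p, `|f p| <= C.
  have /compact_bounded[C [_ /(_ (C + 1)) fC]] :=
    continuous_compact (continuous_subspaceT cf) cK.
  exists (Num.max 0 (C + 1)) => p; have [Kp|/f0 ->] := pselect (K p).
    by rewrite le_max fC ?orbT// ?ltrDl//; exists p.
  by rewrite normr0 le_max lexx.
have mf := continuous_measurable_R3 cf.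
pose I := `[- M, M]%classic : set (measurableTypeR R).
have mI : measurable I by exact: measurable_itv.
have KI x y z : K (x, y, z) -> (I `*` I `*` I) (x, y, z).
  by move=> /KM[? ? ?]; rewrite /I/= !in_itv/= -!ler_norml.
split.
  apply: (@integrable_bounded_support _ _ _ (I `*` I `*` I) C) => //.
  - by apply: measurableX => //; exact: measurableX.
  - have := product_measure1E lebesgue2 mu (measurableX mI mI) mI.
    move=> /= E; rewrite /= [ltLHS]E.
    apply: lte_mul_pinfty => //; last exact: lebesgue_measure_symmetric_itv.
    by rewrite ge0_fin_numE// lebesgue2_square.
  - by move=> [[x y] z] nI; apply: f0 => /KI.
move=> z; apply: (@integrable_bounded_support _ _ _ (I `*` I) C) => //.
- exact: measurableX.
- exact: lebesgue2_square.
- by apply: (measurableT_comp mf); exact: pair2_measurable.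
- by move=> [x y] nI; apply: f0 => /KI[].
Qed.

Lemma scale_add3 (t a b c x y z : R) : t *: ((a, b, c) : R3 R) + (x, y, z) =
  (t * a + x, t * b + y, t * c + z).
Proof. by []. Qed.

(** Fubini's theorem with the j-th coordinate integrated first, where
    [integral_partial_line] gives 0. *)
Lemma integral_partial (G : R3 R -> R) (K : set (R3 R)) j : compact K ->
  (forall x, derivable G x (basis3 j)) -> continuous (partial j G) ->
  (forall x, ~ K x -> G x = 0) -> (forall x, ~ K x -> partial j G x = 0) ->
  (\int[lebesgue2 \x mu]_x (partial j G x)%:E = 0)%E.
Proof.
move=> cK dG cG G0 dG0.
have [i3 i2] := continuous_compact_integrable3 cK cG dG0.
have [M KM] := compact_in_box cK.
have out x y z : M < `|x| \/ M < `|y| \/ M < `|z| -> G (x, y, z) = 0.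
  by move=> H; apply: G0 => /KM[]; case: H => [|[]]; rewrite ltNge => /negP.
case: j => -[|[|[|//]]] lt3 in dG cG dG0 i3 i2 *.
- rewrite -(integral21_prod_meas1 i3); apply: integral0_eq => z _.
  rewrite /fubini_G -(integral21_prod_meas1 (i2 z)).
  apply: integral0_eq => y _.
  have E t : (t, y, z) = t *: basis3 (Ordinal lt3) + (0, y, z).
    by rewrite /basis3 scale_add3/= !(mulr1, mulr0, addr0, add0r).
  rewrite /fubini_G; under eq_integral do rewrite E.
  apply: (@integral_partial_line _ _ _ M) => // t Mt.
  by rewrite -E out//; left.
- rewrite -(integral21_prod_meas1 i3); apply: integral0_eq => z _.
  rewrite /fubini_G -(integral12_prod_meas1 (i2 z)).
  apply: integral0_eq => x _.
  have E t : (x, t, z) = t *: basis3 (Ordinal lt3) + (x, 0, z).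
    by rewrite /basis3 scale_add3/= !(mulr1, mulr0, addr0, add0r).
  rewrite /fubini_F; under eq_integral do rewrite E.
  apply: (@integral_partial_line _ _ _ M) => // t Mt.
  by rewrite -E out//; right; left.
- rewrite -(integral12_prod_meas1 i3); apply: integral0_eq => -[x y] _.
  have E t : (x, y, t) = t *: basis3 (Ordinal lt3) + (x, y, 0).
    by rewrite /basis3 scale_add3/= !(mulr1, mulr0, addr0, add0r).
  rewrite /fubini_F; under eq_integral do rewrite E.
  apply: (@integral_partial_line _ _ _ M) => // t Mt.
  by rewrite -E out//; right; right.
Qed.

End divergence.

(** * Cofactors of gradients have zero integral *)

Section null_lagrangian.
Context {R : realType}.
Local Notation mu := (@lebesgue_measure R).
Implicit Types (f g : R3 R -> R) (Omega : set (R3 R)).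

Lemma partial_eq0 f (K : set (R3 R)) j : closed K ->
  (forall x, ~ K x -> f x = 0) -> forall x, ~ K x -> partial j f x = 0.
Proof.
move=> cK f0 x Kx; rewrite /partial (@near_eq_derive _ _ _ f (cst 0)) ?derive_cst//.
have : nbhs x (~` K) by apply: open_nbhs_nbhs; split => //; exact: closed_openC.
by apply: filterS => y; exact: f0.
Qed.

Lemma smooth_partial f j : smooth f -> smooth (partial j f).
Proof. by move=> sf s; have := sf (rcons s j); rewrite foldr_rcons. Qed.

Lemma smooth_continuous f : smooth f -> continuous f.
Proof. by move=> /(_ [::])[]. Qed.

Lemma smooth_derivable f x j : smooth f -> derivable f x (basis3 j).
Proof. by move=> /(_ [::])[_]; exact. Qed.

Lemma smooth_partialC f j k : smooth f ->
  partial k (partial j f) = partial j (partial k f).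
Proof.
move=> sf; apply/funext => x.
apply: (@mixed_derivatives_eq _ _ f (partial j f) (partial k f) _ _
  (basis3 j) (basis3 k) x) => [y|y|y|y||].
- exact/derivableP/smooth_derivable.
- exact/derivableP/smooth_derivable.
- exact/derivableP/smooth_derivable/smooth_partial.
- exact/derivableP/smooth_derivable/smooth_partial.
- exact/smooth_continuous/smooth_partial/smooth_partial.
- exact/smooth_continuous/smooth_partial/smooth_partial.
Qed.

(** The minor is a divergence:
    [d_j f d_k g - d_k f d_j g = d_j (f d_k g) - d_k (f d_j g)], the second
    derivatives of g cancelling by symmetry. *)
Lemma integral_jacobian_minor f g (K : set (R3 R)) j k :
  smooth f -> smooth g -> compact K -> closed K ->
  (forall x, ~ K x -> f x = 0) ->
  (\int[lebesgue2 \x mu]_x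
     (partial j f x * partial k g x - partial k f x * partial j g x)%:E = 0)%E.
Proof.
move=> sf sg cK clK f0.
have null (i l : 'I_3) :
    let G := f * partial l g in
    partial i G = (fun x => f x * partial i (partial l g) x +
      partial l g x * partial i f x) /\
    (lebesgue2 \x mu)%E.-integrable [set: BR3 R] (EFin \o partial i G) /\
    (\int[lebesgue2 \x mu]_x (partial i G x)%:E = 0)%E.
  move=> G; have sp : smooth (partial l g) := smooth_partial l sg.
  have df x : derivable f x (basis3 i) by exact: smooth_derivable.
  have dg x : derivable (partial l g) x (basis3 i) by exact: smooth_derivable.
  have dG x : derivable G x (basis3 i) := derivableM (df x) (dg x).
  have EG : partial i G = fun x => f x * partial i (partial l g) x +
      partial l g x * partial i f x.
    by apply/funext => x; exact: (deriveM (df x) (dg x)).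
  have cf : continuous f by exact: smooth_continuous.
  have cp : continuous (partial l g) by exact: smooth_continuous.
  have cf' : continuous (partial i f).
    by apply: smooth_continuous; exact: smooth_partial.
  have cp' : continuous (partial i (partial l g)).
    by apply: smooth_continuous; exact: smooth_partial.
  have cG : continuous (partial i G).
    rewrite EG => x; apply: cvgD; apply: cvgM.
    - exact: cf.
    - exact: cp'.
    - exact: cp.
    - exact: cf'.
  have G0 x : ~ K x -> G x = 0 by move=> Kx; rewrite /G/= mulrfctE f0// mul0r.
  have dG0 := partial_eq0 i clK G0.
  split=> //; split.
    by have [] := continuous_compact_integrable3 cK cG dG0.
  exact: (integral_partial cK dG cG G0 dG0).
have [E1 [i1 I1]] := null j k; have [E2 [i2 I2]] := null k j.
rewrite (eq_integral (fun x : BR3 R => (partial j (f * partial k g) x)%:E -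
    (partial k (f * partial j g) x)%:E)%E); last first.
  move=> x _; rewrite -EFinB E1 E2.
  have alg (a b c d p q : R) : c * d - p * q = a * b + d * c - (a * b + q * p).
    by ring.
  by rewrite (smooth_partialC j k sg); congr EFin; exact: alg.
apply: (etrans (integralB_EFin measurableT i1 i2)).
by apply: (etrans (congr2 (fun a b => a - b)%E I1 I2)); rewrite sube0.
Qed.

Lemma integral_LR3_restrict Omega f : (forall x, ~ Omega x -> f x = 0) ->
  (\int[lebesgue3]_(x in Omega) (f x)%:E = \int[@lebesgue3 R]_x (f x)%:E)%E.
Proof.
move=> f0; rewrite integral_mkcond; apply: eq_integral => x _; rewrite patchE.
by case: ifPn => // /negP; rewrite inE => /f0 ->.
Qed.

Lemma open_measurable_LR3 Omega : open Omega ->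
  measurable (Omega : set (LR3 R)).
Proof. by move=> oO; apply: measurable_LR3; exact: open_measurable_R3. Qed.

Lemma continuous_measurable_LR3 Omega f : continuous f ->
  measurable_fun (Omega : set (LR3 R)) (f : LR3 R -> R).
Proof.
by move=> cf; apply: measurable_fun_LR3; exact: continuous_measurable_R3.
Qed.

Lemma continuous_compact_integrable_LR3 Omega f (K : set (R3 R)) :
  open Omega -> compact K -> continuous f -> (forall x, ~ K x -> f x = 0) ->
  lebesgue3.-integrable (Omega : set (LR3 R)) (EFin \o f).
Proof.
move=> oO cK cf f0; apply: (@integrableS _ _ _ lebesgue3 setT) => //.
  exact: open_measurable_LR3.
apply/integrableP; split; first exact/measurable_EFinP/continuous_measurable_LR3.
rewrite (integral_lebesgue3 (f := fun x => `|(f x)%:E|%E)); last first.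
  apply: measurableT_comp => //.
  by apply/measurable_EFinP; apply: continuous_measurable_R3; exact: cf.
by have [/integrableP[]] := continuous_compact_integrable3 cK cf f0.
Qed.

Lemma grad_square_integrable Omega (u : R3 R -> 'cV[R]_3) : open Omega ->
  Ccoo3 Omega u -> square_integrable lebesgue3 (Omega : set (LR3 R)) (grad u).
Proof.
move=> oO Cu; have sm i j : smooth (partial j (fun y => u y i 0)).
  by apply: smooth_partial; case: (Cu i).
split.
  move=> i j; apply: continuous_measurable_LR3; under eq_fun do rewrite mxE.
  exact: smooth_continuous.
have : lebesgue3.-integrable (Omega : set (LR3 R)) (fun x =>
    \sum_i \sum_j (partial j (fun y => u y i 0) x ^+ 2)%:E)%E.
  have mO := open_measurable_LR3 oO.
  apply: integrable_sum => // i _; apply: integrable_sum => // j _.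
  have [su cK _] := Cu i.
  apply: (continuous_compact_integrable_LR3 oO cK).
    have cp : continuous (partial j (fun y => u y i 0)).
      by apply: smooth_continuous; exact: sm.
    by move=> x; apply: cvgM; exact: cp.
  move=> x Kx; rewrite [X in X ^+ 2](partial_eq0 j (@closed_closure _ _) _ Kx) ?expr0n//.
  move=> y Ky; apply/eqP; apply: contra_notT Ky => uy.
  exact: subset_closure.
move=> /(integrable_lty (open_measurable_LR3 oO)); apply: le_lt_trans.
rewrite le_eqVlt; apply/orP; left; apply/eqP; apply: eq_integral => x _.
rewrite sqr_fnormE -sumEFin; apply: eq_bigr => i _.
by rewrite -sumEFin; apply: eq_bigr => j _; rewrite mxE.
Qed.

Lemma integral_cofmx_grad Omega (u : R3 R -> 'cV[R]_3) i j : open Omega ->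
  Ccoo3 Omega u ->
  (\int[lebesgue3]_(x in Omega) (cofmx (grad u x) i j)%:E = 0)%E.
Proof.
move=> oO Cu; set i0 := lift i ord0; set i1 := lift i ord_max.
set j0 := lift j ord0; set j1 := lift j ord_max.
have [sf cK KO] := Cu i0; have [sg _ _] := Cu i1.
set f := fun y => u y i0 0 in sf cK KO; set g := fun y => u y i1 0 in sg.
set K := closure _ in cK KO; have clK : closed K by exact: closed_closure.
have f0 x : ~ K x -> f x = 0.
  move=> Kx; apply/eqP; apply: contra_notT Kx => fx; exact: subset_closure.
pose m x := partial j0 f x * partial j1 g x - partial j1 f x * partial j0 g x.
have E x : cofmx (grad u x) i j = (-1) ^+ (i + j) * m x.
  by rewrite cofmx3E !mxE.
have m0 x : ~ K x -> m x = 0.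
  by move=> Kx; rewrite /m !(partial_eq0 _ clK f0 Kx) !mul0r subrr.
have cm : continuous m.
  move=> x; apply: cvgB; apply: cvgM.
  - exact: (smooth_continuous (smooth_partial j0 sf)).
  - exact: (smooth_continuous (smooth_partial j1 sg)).
  - exact: (smooth_continuous (smooth_partial j1 sf)).
  - exact: (smooth_continuous (smooth_partial j0 sg)).
under eq_integral do rewrite E EFinM.
rewrite integralZl; last 2 first.
- exact: open_measurable_LR3.
- exact: (continuous_compact_integrable_LR3 oO cK cm m0).
rewrite integral_LR3_restrict; last by move=> x Ox; apply: m0 => /KO.
rewrite (integral_lebesgue3 (f := fun x => (m x)%:E)).
  by rewrite (integral_jacobian_minor j0 j1 sf sg cK clK f0) mule0.
by apply/measurable_EFinP; apply: continuous_measurable_R3; exact: cm.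
Qed.

(** Cofactors of gradients of test functions have zero integral, and this passes
    to L2 limits of gradients. *)
Lemma H10_integral_cofmx Omega (u : R3 R -> 'cV[R]_3) (Du : R3 R -> 'M[R]_3) i j :
  open Omega -> H10 Omega u Du ->
  (\int[lebesgue3]_(x in Omega) (cofmx (Du x) i j)%:E = 0)%E.
Proof.
move=> oO [[Lu LDu _] [phi [Cphi cv]]].
have mO := open_measurable_LR3 oO.
apply: (@integral_cofmx_closure _ _ _ lebesgue3 _ mO Du i j LDu) => eps e0.
have nb : nbhs (0 : \bar R)%E (fun x : \bar R => x < eps%:E)%E.
  by apply: open_ereal_lt'; rewrite lte_fin.
have [n _ /(_ n (leqnn n)) /= ne] := cv _ nb; exists (grad (phi n)).
have sn := grad_square_integrable oO (Cphi n).
split=> //; first exact: integral_cofmx_grad (Cphi n).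
have mDB : measurable_fun (Omega : set (LR3 R))
    (fun x : LR3 R => fnorm (Du x - grad (phi n) x) ^+ 2).
  apply: measurable_sqr_fnorm => k l; under eq_fun do rewrite !mxE.
  apply: measurable_funB; first exact: LDu.1.
  by have := sn.1 k l; under eq_fun do rewrite mxE.
have muB : measurable_fun (Omega : set (LR3 R))
    (fun x : LR3 R => fnorm (u x - phi n x) ^+ 2).
  apply: measurable_sqr_fnorm => k l; under eq_fun do rewrite !mxE.
  apply: measurable_funB; first exact: Lu.1.
  rewrite (ord1 l); apply: continuous_measurable_LR3.
  by apply: smooth_continuous; have [] := Cphi n k.
apply: le_lt_trans ne; apply: ge0_le_integral.
- exact: mO.
- by move=> x _; rewrite lee_fin sqr_ge0.
- by apply/measurable_EFinP; exact: mDB.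
- by apply/measurable_EFinP; exact: (measurable_funD muB mDB).
- by move=> x _; rewrite lee_fin lerDr sqr_ge0.
Qed.

End null_lagrangian.

Theorem lemma2p10 (R : realType) (Omega omega : set (R3 R))
    (hOmega : is_domain Omega) (homega : omega `<=` Omega)
    (momega : measurable (omega : set (LR3 R)))
    (T0 : 'M[R]_3) (T : R3 R -> 'M[R]_3)
    (hT : T = (fun x => \1_omega x *: T0))
    (hT0 : fnorm T0 <= 2 * Num.sqrt 3) :
  (forall u : R3 R -> 'cV[R]_3, Ccoo3 Omega u ->
     (0 <= Ftilde Omega T (grad u))%E) /\
  (fnorm T0 < 2 * Num.sqrt 3 ->
   exists gamma : R, 0 < gamma /\
     forall (u : R3 R -> 'cV[R]_3) (Du : R3 R -> 'M[R]_3),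
       H10 Omega u Du ->
       (gamma%:E * \int[lebesgue3]_(x in Omega) (fnorm (Du x) ^+ 2)%:E
          <= Ftilde Omega T Du)%E).
Proof.
have [oO _ _] := hOmega; have mO := open_measurable_LR3 oO.
have s3 : 0 < 2 * Num.sqrt 3 :> R by rewrite mulr_gt0// sqrtr_gt0.
rewrite {}hT /Ftilde; split.
  move=> u Cu; apply: le_trans (coercive_of_null_lagrangian mO T0 momega
    (grad_square_integrable oO Cu) (fun i j => integral_cofmx_grad i j oO Cu)).
  apply: mule_ge0; first by rewrite lee_fin subr_ge0 ler_pdivrMr ?mul1r.
  by apply: integral_ge0 => x _; rewrite lee_fin sqr_ge0.
move=> hlt; exists (1 - fnorm T0 / (2 * Num.sqrt 3)); split.
  by rewrite subr_gt0 ltr_pdivrMr ?mul1r.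
move=> u Du HDu; have [[_ LDu _] _] := HDu.
exact: (coercive_of_null_lagrangian mO T0 momega LDu
  (fun i j => H10_integral_cofmx i j oO HDu)).
Qed.
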